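(* Let $(f_{k,m},T_k)$ be a recursion structure on $\{C^n(\mu)\}_{n\ge 0}$ satisfying the chain condition $\delta^{n+1}(x_{n+2};\mu'')\,\delta^n(x_{n+1};\mu')=0$ on the domains $\mathfrak Z_n$, for all $n$. Then $$ H^n(\mu)\ \cong\ \Big\{\mathcal Z\in C^n(\mu)\ \Big|\ \sum_{k=1}^n\sum_{m\ge0} f_{k,m}(x_{n+1};\mu')\,\big(T_k(v_{n+1}[m]).\mathcal Z\big)(\mathbf z_n,\mu)=0\ \text{ for all admissible } x_{n+1}=(v_{n+1},z_{n+1}),\ \mu'\Big\}\Big/\operatorname{Im}(\delta^{n-1}), $$ i.e. $H^n(\mu)$ is the space of solutions $\mathcal Z$ of the functional equation $$ (\ast)\qquad \sum_{k=1}^n\sum_{m\ge0} f_{k,m}(x_{n+1};\mu')\,\big(T_k(v_{n+1}[m]).\mathcal Z\big)(\mathbf z_n,\mu)=0 $$ on $\mathfrak Z_n$, modulo those that are themselves of the form $\delta^{n-1}(x_n;\mu').\mathcal Z'$ for some $\mathcal Z'\in C^{n-1}(\mu'')$. In particular, every function $\mathcal Z(\mathbf z_n',\widetilde\mu)$ recursively generated from the base case $C^0(\mu)=\mathbb C$ by iterating the recursion $\mathcal Z_{j+1}=\delta^j(x_{j+1};\mu'_{j+1}).\mathcal Z_j$, that is, of the form $$ (\ast\ast)\qquad \mathcal Z(\mathbf z_n',\widetilde\mu)=\mathcal D(\mathbf z_n',\mu').Z(\mu),\qquad \mathcal D:=\delta^{n-1}(x_n;\mu'_{n-1})\cdots\delta^0(x_1;\mu'_1),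 $$ with $Z(\mu)\in C^0(\mu)$, represents the zero class in $H^n(\mu)$ for $n\ge1$; and the recursion cohomology is non-zero exactly when $(\ast)$ admits solutions on $\mathfrak Z_n$ that are not of this recursively generated form.
   Context: Let $M$ be a complex curve (or a family of complex curves parametrized by a modulus $\mu$ in a domain $\mathcal M$). Fix an auxiliary set $\mathcal A$ of insertion labels (e.g. a vertex operator algebra, a module over one, or a set of formal mode indices), with an action of modes: for $u,v\in\mathcal A$ and $m\ge0$, $u[m].v\in\mathcal A$ is the label obtained from $v$ by the action of the $m$-th mode of $u$. Write $x=(v,z)\in\mathcal A\times\mathbb C$ for the label $v$ inserted at the point $z$. Primed symbols $\mu',\mu''$ denote auxiliary moduli, and $\mu\cup\mu'$ the combined modulus. Spaces. For $n\ge0$, $C^n(\mu)$ is the vector space of complex-valued functions $\mathcal Z(\mathbf z_n,\mu)$, $\mathbf z_n=(z_1,\dots,z_n)\in M^n$, depending linearly on $n$ insertion labels $\mathbf v_n=(v_1,\dots,v_n)\in\mathcal A^n$ (regarded as fixed and suppressed from the notation unless they are varied), holomorphic in $\mathbf z_n$ on the complement of finitely many hyperplanes $z_i=z_j$, and satisfying the convergence and modular-covariance conditions fixed for the example considered. $C^0(\mu):=\mathbb C$. Slot operators. For $n\ge1$, $1\le k\le n$, $m\ge0$ and $v_{n+1}\in\mathcal A$, $T_k(v_{n+1}[m]):C^n(\mu)\to C^n(\mu)$ is the linear operator modifying only the $k$-th label: $$\big(T_k(v_{n+1}[m]).\mathcal Z\big)(\mathbf z_n,\mu):=\mathcal Z_{v_1,\dots,v_{n+1}[m].v_k,\dots,v_n}(\mathbf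 z_n,\mu).$$ Recursion structure. This is a choice, for every $n\ge0$, of holomorphic coefficient functions $f_{k,m}(x_{n+1};\mu')$ ($1\le k\le n$, $m\ge0$, with only finitely many $m$ contributing at each order; dependence on $n$ suppressed) such that the linear operator $\delta^n(x_{n+1};\mu'):C^n(\mu)\to C^{n+1}(\mu\cup\mu')$, $$\big(\delta^n(x_{n+1};\mu').\mathcal Z\big)(\mathbf z_{n+1},\mu\cup\mu'):=\sum_{k=1}^n\sum_{m\ge0}f_{k,m}(x_{n+1};\mu')\big(T_k(v_{n+1}[m]).\mathcal Z\big)(\mathbf z_n,\mu),$$ is well defined, i.e. the right-hand side, viewed as a function of the $n+1$ independent points $(\mathbf z_n,z_{n+1})$ (with $z_{n+1}$ a new argument entering only through the coefficients, and $v_{n+1}$ the new label), lies in $C^{n+1}(\mu\cup\mu')$. Chain condition. At level $n$ it is the identity $\delta^{n+1}(x_{n+2};\mu'')\,\delta^n(x_{n+1};\mu')=0$ of linear operators $C^n(\mu)\to C^{n+2}(\mu\cup\mu'\cup\mu'')$, for all admissible $x_{n+1},x_{n+2},\mu',\mu''$. $\mathfrak Z_n\subset M^n\times\mathcal M$ denotes the domain of $(\mathbf z_n,\mu)$ on which every function in $C^n(\mu)$ is required to be evaluated for this identity to hold; all spaces are restricted to these domains. Cohomology. The $n$-th recursion cohomology is $$H^n(\mu):=\operatorname{Ker}\big(\delta^n:C^n(\mu)\to C^{n+1}(\mu')\big)\big/\operatorname{Im}\big(\delta^{n-1}:C^{n-1}(\mu'')\to C^n(\mu)\big).$$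
   Formalization: In the last clause, ''not of this recursively generated form'' is taken as ''not in Im(δ^{n-1})'' (span over all decompositions of μ), not as ''not of the form (∗∗)'': since δ^0 = 0, (∗∗) yields only 0 for n≥1, and the literal criterion fails, e.g. when H^2 = 0 but Ker δ^2 ≠ 0. *)

(* Defs.v *)
From HB Require Import structures.
From mathcomp Require Import all_boot all_order all_algebra.
From mathcomp Require Import complex generic_quotient ring_quotient.
From mathcomp Require Import all_classical all_reals all_analysis.

Set Implicit Arguments.
Unset Strict Implicit.
Unset Printing Implicit Defensive.

Import Order.TTheory GRing.Theory Num.Theory numFieldNormedType.Exports.

Local Open Scope classical_set_scope.
Local Open Scope ring_scope.
Local Open Scope quotient_scope.

Section LinearAlgebra.
Variables (K : comNzRingType) (V : lmodType K).

Record subspace (S : submodClosed V) := Subspace {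
  subspace_val : V;
  subspace_valP : subspace_val \in S }.

HB.instance Definition _ (S : submodClosed V) :=
  [isSub for @subspace_val S].
HB.instance Definition _ (S : submodClosed V) :=
  [Choice of subspace S by <:].
HB.instance Definition _ (S : submodClosed V) :=
  [SubChoice_isSubLmodule of subspace S by <:].

Lemma subspace_val_linear (S : submodClosed V) : linear (@subspace_val S).
Proof. exact: (linearP (\val : subspace S -> V)). Qed.

Definition span (G : set V) : {pred V} := fun v =>
  `[< exists s : seq (K * V),
        (forall p, p \in s -> G p.2) /\ v = \sum_(p <- s) p.1 *: p.2 >].

Lemma span_submod_closed (G : set V) : submod_closed (span G).
Proof.
split=> [|a u v /asboolP[s [sG ->]] /asboolP[t [tG ->]]].
  by apply/asboolP; exists [::]; rewrite big_nil.
apply/asboolP; exists ([seq (a * p.1, p.2) | p <- s] ++ t); split.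
  move=> p; rewrite mem_cat => /orP[/mapP[q qs ->]|/tG//].
  exact: (sG q qs).
rewrite big_cat big_map /= scaler_sumr; congr (_ + _).
by apply: eq_bigr => p _; rewrite scalerA.
Qed.

HB.instance Definition _ (G : set V) :=
  GRing.isSubmodClosed.Build K V (span G) (span_submod_closed G).

End LinearAlgebra.

Section QuotientSpace.
Variables (K : nzRingType) (V : lmodType K).

(* [submodClosed] only inherits from the semimodule closure predicates, while
   [Quotient.quot] wants closure under opposites. *)
Definition submod_pred (I : submodClosed V) : {pred V} := fun v => v \in I.

Lemma submod_pred_zmod_closed (I : submodClosed V) : zmod_closed (submod_pred I).
Proof.
split=> [|u v uI vI]; rewrite /submod_pred !unfold_in; first exact: (rpred0 I).
by rewrite -scaleN1r; apply: (rpredD (S := I)) => //; apply: (rpredZ (s := I)).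
Qed.

HB.instance Definition _ (I : submodClosed V) :=
  GRing.isZmodClosed.Build V (submod_pred I) (submod_pred_zmod_closed I).

Definition quotient_space (I : submodClosed V) := @Quotient.quot V (submod_pred I).

HB.instance Definition _ (I : submodClosed V) :=
  GRing.Zmodule.on (quotient_space I).
HB.instance Definition _ (I : submodClosed V) :=
  EqQuotient.on (quotient_space I).

Variable I : submodClosed V.
Local Notation Q := (quotient_space I).

Definition quotient_class (v : V) : Q := \pi_Q v.

Lemma quotient_classB : {morph quotient_class : u v / u - v}.
Proof.
move=> u v; exact: (raddfB (\pi_(@Quotient.quot V (submod_pred I)))).
Qed.

HB.instance Definition _ :=
  GRing.isZmodMorphism.Build V Q quotient_class quotient_classB.

Lemma quotient_class_surj (x : Q) : exists v, x = quotient_class v.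
Proof. by exists (repr x); rewrite /quotient_class reprK. Qed.

Lemma quotient_class_eq (u v : V) :
  (quotient_class u == quotient_class v) = (u - v \in I).
Proof.
by rewrite /quotient_class -[LHS](@Quotient.idealrBE V (submod_pred I)).
Qed.

Definition quotient_scale (a : K) (x : Q) : Q := quotient_class (a *: repr x).

Lemma quotient_classZ (a : K) (v : V) :
  quotient_scale a (quotient_class v) = quotient_class (a *: v).
Proof.
apply/eqP; rewrite quotient_class_eq -scalerBr; apply: (rpredZ (s := I)).
by rewrite -quotient_class_eq /quotient_class reprK.
Qed.

Lemma quotient_scaleA (a b : K) (x : Q) :
  quotient_scale a (quotient_scale b x) = quotient_scale (a * b) x.
Proof.
by have [v ->] := quotient_class_surj x; rewrite !quotient_classZ scalerA.
Qed.

Lemma quotient_scale1 : left_id 1 quotient_scale.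
Proof.
by move=> x; have [v ->] := quotient_class_surj x;
  rewrite quotient_classZ scale1r.
Qed.

Lemma quotient_scaleDr : right_distributive quotient_scale +%R.
Proof.
move=> a x y.
have [u ->] := quotient_class_surj x; have [v ->] := quotient_class_surj y.
by rewrite -raddfD !quotient_classZ scalerDr raddfD.
Qed.

Lemma quotient_scaleDl (x : Q) : {morph quotient_scale^~ x : a b / a + b}.
Proof.
move=> a b; have [v ->] := quotient_class_surj x.
by rewrite !quotient_classZ scalerDl raddfD.
Qed.

HB.instance Definition _ := GRing.Zmodule_isLmodule.Build K Q
  quotient_scaleA quotient_scale1 quotient_scaleDr quotient_scaleDl.

Lemma quotient_class_scalable : scalable quotient_class.
Proof. by move=> a v; rewrite -quotient_classZ. Qed.

HB.instance Definition _ :=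
  GRing.isScalable.Build K V Q _ quotient_class quotient_class_scalable.

End QuotientSpace.

Section Subquotient.
Variables (K : comNzRingType) (V : lmodType K) (U W : submodClosed V).

Definition restrict_sub : {pred subspace U} := fun u => subspace_val u \in W.

Lemma restrict_sub_submod_closed : submod_closed restrict_sub.
Proof.
split=> [|a u v]; rewrite /restrict_sub !unfold_in /=; first exact: (rpred0 W).
move=> uW vW.
by apply: (rpredD (S := W)) => //; apply: (rpredZ (s := W)).
Qed.

HB.instance Definition _ := GRing.isSubmodClosed.Build K (subspace U)
  restrict_sub restrict_sub_submod_closed.

(* [U / (U \cap W)], that is [U / W] as soon as [W] lies in [U]. *)
Definition subquotient := quotient_space restrict_sub.

HB.instance Definition _ := GRing.Lmodule.on subquotient.

Definition subquotient_class (v : V) (vU : v \in U) : subquotient :=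
  quotient_class restrict_sub (Subspace vU).

End Subquotient.

Definition complex_numbers (R : realType) : numClosedFieldType := R[i].

Section ComplexCurves.
Variables (R : realType) (X : Type).
Local Notation C := (complex_numbers R).

Record chart := Chart {
  chart_dom : set X;
  coord : X -> C;
  param : C -> X }.

(* A complex curve supported by a subset of [X]: the topology is the one
   induced by the atlas, which need not be maximal. *)
Record complex_curve := ComplexCurve {
  carrier : set X;
  atlas : set chart;
  chart_sub : forall c, atlas c -> chart_dom c `<=` carrier;
  chart_cover : forall x, carrier x -> exists2 c, atlas c & chart_dom c x;
  coordK : forall c, atlas c ->
    forall x, chart_dom c x -> param c (coord c x) = x;
  chart_open : forall c d, atlas c -> atlas d ->
    open (coord c @` (chart_dom c `&` chart_dom d) : set C^o);
  chart_transition : forall c d, atlas c -> atlas d ->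
    forall x, chart_dom c x -> chart_dom d x ->
    differentiable (coord d \o param c : C^o -> C^o) (coord c x : C^o);
  curve_hausdorff : forall x y, carrier x -> carrier y -> x <> y ->
    exists c d (A B : set C^o),
      [/\ atlas c, atlas d, chart_dom c x & chart_dom d y] /\
      [/\ nbhs (coord c x : C^o) A, nbhs (coord d y : C^o) B &
        (chart_dom c `&` coord c @^-1` A) `&`
        (chart_dom d `&` coord d @^-1` B) = set0];
  curve_second_countable : exists A : set chart,
    [/\ countable A, A `<=` atlas & carrier `<=` \bigcup_(c in A) chart_dom c]
}.

Definition holomorphic_at (M : complex_curve) n (F : ('I_n -> X) -> C)
    (z : 'I_n -> X) : Prop :=
  forall c : 'I_n -> chart,
    (forall i, atlas M (c i) /\ chart_dom (c i) (z i)) ->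
    \forall w \near (\row_i coord (c i) (z i) : 'rV[C]_n),
      differentiable
        ((fun w : 'rV[C]_n => F (fun i => param (c i) (w ord0 i)))
           : 'rV[C]_n -> C^o) w.

Definition off_hyperplanes n (S : {set 'I_n * 'I_n}) (z : 'I_n -> X) : Prop :=
  forall i j, (i, j) \in S -> i != j -> z i <> z j.

Definition holomorphic_off_hyperplanes (M : complex_curve) n (D : set ('I_n -> X))
    (f : D -> C) : Prop :=
  exists S : {set 'I_n * 'I_n}, exists F : ('I_n -> X) -> C,
    [/\ forall z, (forall i, carrier M (z i)) -> off_hyperplanes S z ->
          holomorphic_at M F z,
        D `<=` off_hyperplanes S &
        forall z : D, f z = F (val z)].

Lemma holomorphic_at_linear (M : complex_curve) n F G z (a : C) :
  @holomorphic_at M n F z -> holomorphic_at M G z ->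
  holomorphic_at M (fun x => a * F x + G x) z.
Proof.
move=> hF hG c cz; near=> w.
by apply: differentiableD; [apply: differentiableZ|]; near: w;
  [exact: hF|exact: hG].
Unshelve. all: end_near. Qed.

Lemma holomorphic_off_hyperplanes0 (M : complex_curve) n (D : set ('I_n -> X)) :
  holomorphic_off_hyperplanes M (fun _ : D => 0).
Proof.
exists finset.set0, (fun=> 0); split=> // [z _ _ c _|z _ i j].
  by near=> w; exact: differentiable_cst.
by rewrite inE.
Unshelve. all: end_near. Qed.

Lemma holomorphic_off_hyperplanes_linear (M : complex_curve) n (D : set ('I_n -> X))
    (a : C) (f g : D -> C) :
  holomorphic_off_hyperplanes M f -> holomorphic_off_hyperplanes M g ->
  holomorphic_off_hyperplanes M (fun z => a * f z + g z).
Proof.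
move=> [S [F [hF DS fF]]] [T [G [hG DT gG]]].
exists (S :|: T)%SET, (fun z => a * F z + G z); split=> [z Mz zST|z Dz|z].
- by apply: holomorphic_at_linear; [apply: hF|apply: hG] => // i j ij;
    apply: zST; rewrite inE ij ?orbT.
- by move=> i j; rewrite inE => /orP[]; [exact: DS|exact: DT].
- by rewrite fF gG.
Qed.

End ComplexCurves.

Section Cochains.
Variable R : realType.
Local Notation C := (complex_numbers R).

(* The labels form a mere set; what "linear in the labels" means is recorded by
   their values [label_vec] in a vector space.  Taking that map to be the
   identity of a vertex algebra, or the basis vectors of a free vector space,
   gives back linear labels and formal mode indices respectively. *)
Record insertion_labels := InsertionLabels {
  label :> Type;
  mode : label -> nat -> label -> label;
  label_space : lmodType C;
  label_vec : label -> label_space }.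

Definition set_slot (T : Type) n (v : 'I_n -> T) (k : 'I_n) (a : T) :=
  fun i => if i == k then a else v i.

Definition front (T : Type) n (v : 'I_n.+1 -> T) : 'I_n -> T :=
  fun i => v (widen_ord (leqnSn n) i).

Definition last_slot (T : Type) n (v : 'I_n.+1 -> T) : T := v ord_max.

Definition labelled (A X : Type) n (D : set ('I_n -> X)) : lmodType C :=
  ('I_n -> A) -> D -> C^o.

Definition linear_labels (A : insertion_labels) X n (D : set ('I_n -> X))
    (Z : labelled A D) : Prop :=
  forall (v : 'I_n -> A) (k : 'I_n) (z : D),
    exists L : {linear label_space A -> C^o},
      forall a : A, Z (set_slot v k a) z = L (label_vec a).

Definition slot_fun (A : insertion_labels) X n (D : set ('I_n -> X))
    (k : 'I_n) (u : A) (m : nat) (Z : labelled A D) : labelled A D :=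
  fun v z => Z (set_slot v k (mode u m (v k))) z.

Definition is_cochain (A : insertion_labels) X n (M : complex_curve R X)
    (D : set ('I_n -> X)) (P : set (labelled A D)) (Z : labelled A D) : Prop :=
  [/\ linear_labels Z, forall v, holomorphic_off_hyperplanes M (Z v) & P Z].

(* [zdom n mu] is the fibre over [mu] of the domain on which the functions of
   level [n] are evaluated, [conds n mu] stands for the convergence and
   modular-covariance conditions, and [admissible n mu] for the auxiliary moduli
   which may be combined with [mu] at level [n].  The family of curves is
   carried by a common set of points, so that [z_1, ..., z_n] can be evaluated
   both at [mu] and at a combined modulus; a single curve is the case where
   [curve] is constant. *)
Record cochain_system := CochainSystem {
  labels : insertion_labels;
  modulus : Type;
  munion : modulus -> modulus -> modulus;
  admissible : nat -> modulus -> set modulus;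
  point : Type;
  curve : modulus -> complex_curve R point;
  zdom : forall n, modulus -> set ('I_n -> point);
  conds : forall n (mu : modulus), set (labelled labels (@zdom n mu));
  zdom_curve : forall n mu (z : 'I_n -> point), zdom mu z ->
    forall i, carrier (curve mu) (z i);
  zdom_front : forall n mu mu' (z : 'I_n.+1 -> point), admissible n mu mu' ->
    zdom (munion mu mu') z -> zdom mu (front z);
  conds_zero : forall n mu, @conds n mu 0;
  conds_linear : forall n mu (a : C) Z Z', @conds n mu Z -> @conds n mu Z' ->
    @conds n mu (a *: Z + Z');
  (* the next two fields make the space of level 0 equal to the scalars *)
  zdom0 : forall mu, @zdom 0 mu = setT;
  conds0 : forall mu, @conds 0 mu = setT;
  slot_stable : forall n mu k u m Z,
    is_cochain (curve mu) (@conds n mu) Z ->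
    is_cochain (curve mu) (@conds n mu) (slot_fun k u m Z) }.

Variable S : cochain_system.
Local Notation A := (labels S).

Definition cochain_pred n (mu : modulus S) : {pred labelled A (@zdom S n mu)} :=
  fun Z => `[< is_cochain (curve mu) (@conds S n mu) Z >].

Lemma cochain_submod_closed n mu : submod_closed (@cochain_pred n mu).
Proof.
split=> [|a Z Z' /asboolP[lZ mZ cZ] /asboolP[lZ' mZ' cZ']]; apply/asboolP.
  split; last exact: conds_zero.
    by move=> v k z; exists (\0 : {linear label_space A -> C^o}).
  by move=> v; exact: holomorphic_off_hyperplanes0.
split; last exact: conds_linear.
  move=> v k z; have [L LE] := lZ v k z; have [L' LE'] := lZ' v k z.
  exists (a \*: L \+ L' : {linear label_space A -> C^o}) => b.
  by rewrite /= -LE -LE'.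
by move=> v; exact: holomorphic_off_hyperplanes_linear.
Qed.

HB.instance Definition _ n (mu : modulus S) :=
  GRing.isSubmodClosed.Build C (labelled A (@zdom S n mu)) (@cochain_pred n mu)
    (@cochain_submod_closed n mu).

Definition cochain n (mu : modulus S) := subspace (@cochain_pred n mu).

HB.instance Definition _ n (mu : modulus S) := GRing.Lmodule.on (cochain n mu).

Lemma cochain_val n mu (Z : cochain n mu) :
  is_cochain (curve mu) (@conds S n mu) (subspace_val Z).
Proof. by case: Z => Z /= /asboolP. Qed.

Definition cochain_eval n mu (Z : cochain n mu) : ('I_n -> A) -> @zdom S n mu -> C :=
  subspace_val Z.

Lemma cochain_eval_linear n mu (a : C) (Z Z' : cochain n mu) v z :
  cochain_eval (a *: Z + Z') v z = a * cochain_eval Z v z + cochain_eval Z' v z.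
Proof. by rewrite /cochain_eval subspace_val_linear. Qed.

Lemma cochain_eval_inj n mu (Z Z' : cochain n mu) :
  (forall v z, cochain_eval Z v z = cochain_eval Z' v z) -> Z = Z'.
Proof.
by move=> ZZ'; apply: val_inj; apply/funext => v; apply/funext => z; exact: ZZ'.
Qed.

(* $T_k(u[m])$ *)
Definition slot n mu (k : 'I_n) (u : A) (m : nat) (Z : cochain n mu) :
    cochain n mu :=
  Subspace (asboolT (slot_stable k u m (cochain_val Z))
    : slot_fun k u m (subspace_val Z) \in @cochain_pred n mu).

Lemma slot_linear n mu k u m : linear (@slot n mu k u m).
Proof.
by move=> a Z Z'; apply: cochain_eval_inj => v z; rewrite cochain_eval_linear;
  exact: cochain_eval_linear.
Qed.

HB.instance Definition _ n mu k u m := GRing.isLinear.Build C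
  (cochain n mu) (cochain n mu) _ (@slot n mu k u m) (@slot_linear n mu k u m).

End Cochains.

Section Recursion.
Variables (R : realType) (S : cochain_system R).
Local Notation C := (complex_numbers R).
Local Notation A := (labels S).

Definition snoc (T : Type) n (v : 'I_n -> T) (a : T) : 'I_n.+1 -> T :=
  fun i => if unlift ord_max i is Some j then v j else a.

Lemma snoc_front (T : Type) n (v : 'I_n.+1 -> T) :
  snoc (front v) (last_slot v) = v.
Proof.
apply/funext => i; rewrite /snoc /front /last_slot.
case: unliftP => [j ->|-> //]; congr (v _); apply: val_inj => /=.
by rewrite /bump leqNgt ltn_ord.
Qed.

Definition coefficients :=
  forall n, 'I_n -> nat -> A -> point S -> modulus S -> C.

(* The admissible values of the point [z_{n+1}] given [z_1, ..., z_n]. *)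
Definition admissible_point n (mu mu' : modulus S) (z : @zdom R S n mu)
    (p : point S) : Prop :=
  zdom (munion mu mu') (snoc (val z) p).

Definition rec_term (f : coefficients) n (mu mu' : modulus S)
    (Z : cochain n mu) (u : A) (p : point S) (v : 'I_n -> A)
    (z : @zdom R S n mu) (k : 'I_n) (m : nat) : C :=
  f n k m u p mu' * cochain_eval (slot k u m Z) v z.

(* The left-hand side of the functional equation; [\sum_(m \in _)] is a sum of
   finite support, by [coef_finite] below. *)
Definition rec_sum (f : coefficients) n (mu mu' : modulus S)
    (Z : cochain n mu) (u : A) (p : point S) (v : 'I_n -> A)
    (z : @zdom R S n mu) : C :=
  \sum_(k < n) \sum_(m \in [set: nat]) rec_term f mu' Z u p v z k m.

Definition front_point n (mu mu' : modulus S) (a : admissible n mu mu')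
    (z : @zdom R S n.+1 (munion mu mu')) : @zdom R S n mu :=
  SigSub (mem_set (zdom_front a (set_valP z))).

Definition delta_fun (f : coefficients) n (mu mu' : modulus S)
    (a : admissible n mu mu') (Z : cochain n mu) :
    labelled R A (@zdom R S n.+1 (munion mu mu')) :=
  fun v z => rec_sum f mu' Z (last_slot v) (last_slot (val z))
               (front v) (front_point a z).

Record recursion_structure := RecursionStructure {
  coef :> coefficients;
  coef_holomorphic : forall n mu mu' (k : 'I_n) m u (z : @zdom R S n mu) p,
    admissible n mu mu' -> admissible_point mu' z p ->
    holomorphic_at (curve (munion mu mu'))
      (fun w : 'I_1 -> point S => coef k m u (w ord0) mu') (fun=> p);
  coef_finite : forall n mu mu' (Z : cochain n mu) u p v z k,
    admissible n mu mu' -> admissible_point mu' z p ->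
    finite_set [set m | rec_term coef mu' Z u p v z k m != 0];
  delta_cochain : forall n mu mu' (a : admissible n mu mu') (Z : cochain n mu),
    is_cochain (curve (munion mu mu')) (@conds R S n.+1 (munion mu mu'))
      (delta_fun coef a Z) }.

Lemma fsum_trunc (F : nat -> C) : finite_set [set m | F m != 0] ->
  exists N, forall M, (N <= M)%N -> \sum_(m \in [set: nat]) F m = \sum_(m < M) F m.
Proof.
move=> finF; have [N FN] : exists N, forall m, F m != 0 -> (m < N)%N.
  have /finite_seqP[s sE] := finF.
  exists (\max_(m <- s) m).+1 => m Fm; rewrite ltnS.
  suff ms : m \in s by exact: (@leq_bigmax_seq nat s xpredT id m ms isT).
  by have : [set m | F m != 0] m by []; rewrite sE.
exists N => M NM; rewrite fsbig_ord; apply/esym/fsbig_widen => // m [_ /= mM].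
apply: contra_notP mM => /eqP/FN mN; exact: leq_trans mN NM.
Qed.

Variable f : recursion_structure.

Lemma rec_sum_linear n mu mu' (a : C) (Z Z' : cochain n mu) u p v z :
  admissible n mu mu' -> admissible_point mu' z p ->
  rec_sum f mu' (a *: Z + Z') u p v z
    = a * rec_sum f mu' Z u p v z + rec_sum f mu' Z' u p v z.
Proof.
move=> adm admp; rewrite /rec_sum mulr_sumr -big_split /=.
apply: eq_bigr => k _.
have [N ZN] := fsum_trunc (coef_finite f Z u v k adm admp).
have [N' ZN'] := fsum_trunc (coef_finite f Z' u v k adm admp).
have [M ZM] := fsum_trunc (coef_finite f (a *: Z + Z') u v k adm admp).
pose L := maxn M (maxn N N').
rewrite (ZN L) ?(ZN' L) ?(ZM L) ?leq_max ?leqnn ?orbT //.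
rewrite mulr_sumr -big_split /=; apply: eq_bigr => m _.
by rewrite /rec_term linearP cochain_eval_linear mulrDr mulrCA.
Qed.

Lemma front_admissible n mu mu' (a : admissible n mu mu')
    (z : @zdom R S n.+1 (munion mu mu')) :
  admissible_point mu' (front_point a z) (last_slot (val z)).
Proof. by rewrite /admissible_point /= snoc_front; exact: set_valP. Qed.

Definition delta n (mu mu' : modulus S) (a : admissible n mu mu')
    (Z : cochain n mu) : cochain n.+1 (munion mu mu') :=
  Subspace (asboolT (delta_cochain f a Z)
    : delta_fun f a Z \in @cochain_pred R S n.+1 (munion mu mu')).

Lemma delta_linear n mu mu' (a : admissible n mu mu') : linear (delta a).
Proof.
move=> c Z Z'; apply: cochain_eval_inj => v z; rewrite cochain_eval_linear.
by apply: rec_sum_linear => //; exact: front_admissible.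
Qed.

HB.instance Definition _ n mu mu' (a : admissible n mu mu') :=
  GRing.isLinear.Build C (cochain n mu) (cochain n.+1 (munion mu mu')) _
    (delta a) (delta_linear a).

Definition chain_condition : Prop :=
  forall n mu mu' mu'' (a : admissible n mu mu')
    (a' : admissible n.+1 (munion mu mu') mu'') (Z : cochain n mu),
    delta a' (delta a Z) = 0.

Definition delta_ker n (mu : modulus S) : {pred cochain n mu} :=
  fun Z => `[< forall mu' (a : admissible n mu mu'), delta a Z = 0 >].

Lemma delta_ker_submod_closed n mu : submod_closed (@delta_ker n mu).
Proof.
split=> [|c Z Z' /asboolP ZK /asboolP ZK']; apply/asboolP => mu' a.
  exact: linear0.
by rewrite delta_linear ZK ZK' scaler0 addr0.
Qed.

HB.instance Definition _ n mu := GRing.isSubmodClosed.Build C (cochain n mu)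
  (@delta_ker n mu) (@delta_ker_submod_closed n mu).

Inductive delta_value : forall n (mu : modulus S), cochain n mu -> Prop :=
| DeltaValue n mu mu' (a : admissible n mu mu') (Z : cochain n mu) :
    delta_value (delta a Z).

(* [mu] may decompose in several ways as [munion mu'' mu'], and the images of
   the corresponding operators are summed; at level 0 this is the null space. *)
Definition delta_im n (mu : modulus S) : {pred cochain n mu} :=
  span (@delta_value n mu).

HB.instance Definition _ n mu := GRing.isSubmodClosed.Build C (cochain n mu)
  (@delta_im n mu) (@span_submod_closed C (cochain n mu) (@delta_value n mu)).

Definition cohomology n (mu : modulus S) : lmodType C :=
  subquotient (@delta_ker n mu) (@delta_im n mu).

Definition functional_equation n (mu : modulus S) (Z : cochain n mu) : Prop :=
  forall mu', admissible n mu mu' -> forall u p v (z : @zdom R S n mu),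
    admissible_point mu' z p -> rec_sum f mu' Z u p v z = 0.

Definition solutions n (mu : modulus S) : {pred cochain n mu} :=
  fun Z => `[< functional_equation Z >].

Lemma solutions_submod_closed n mu : submod_closed (@solutions n mu).
Proof.
have sol0 : functional_equation (0 : cochain n mu).
  move=> mu' adm u p v z admp.
  have := rec_sum_linear (-1) (0 : cochain n mu) 0 u v adm admp.
  by rewrite scaler0 addr0 mulN1r addNr.
split=> [|c Z Z' /asboolP ZS /asboolP ZS']; apply/asboolP; first exact: sol0.
move=> mu' adm u p v z admp.
by rewrite rec_sum_linear // ZS // ZS' // mulr0 addr0.
Qed.

HB.instance Definition _ n mu := GRing.isSubmodClosed.Build C (cochain n mu)
  (@solutions n mu) (@solutions_submod_closed n mu).

Inductive recursively_generated :
    forall n (mu : modulus S), cochain n mu -> Prop :=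
| GeneratedBase mu (Z : cochain 0 mu) : recursively_generated Z
| GeneratedStep n mu mu' (a : admissible n mu mu') (Z : cochain n mu) :
    recursively_generated Z -> recursively_generated (delta a Z).

End Recursion.

Arguments delta_ker {R S} f n mu _.
Arguments delta_im {R S} f n mu _.
Arguments solutions {R S} f n mu _.

Lemma level0_scalars (R : realType) (S : cochain_system R) (mu : modulus S)
    (c : complex_numbers R) :
  exists! Z : cochain 0 mu, forall v z, cochain_eval Z v z = c.
Proof.
have cP : (fun _ _ => c) \in @cochain_pred R S 0 mu.
  apply/asboolP; split; first by move=> v [].
    move=> v; exists finset.set0, (fun=> c); split=> // [z _ _ d _|z _ []//].
    by near=> w; exact: differentiable_cst.
  by rewrite conds0.
exists (Subspace cP); split=> // Z Zc; apply: cochain_eval_inj => v z.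
by rewrite Zc.
Unshelve. all: end_near. Qed.

(* Main.v *)
Require Import Defs.
From HB Require Import structures.
From mathcomp Require Import all_boot all_order all_algebra.
From mathcomp Require Import complex generic_quotient ring_quotient.
From mathcomp Require Import all_classical all_reals all_analysis.

(** The cochain [delta a Z] is by definition the left-hand side of the
    functional equation, read as a function of [n + 1] independent labels and
    points.  Splitting such a family into its first [n] entries and its last
    one is a bijection, so [delta a Z] vanishes for every admissible modulus
    exactly when [Z] solves the functional equation ([delta_ker_solutions]).
    Cohomology and solutions modulo the image are therefore quotients of one
    and the same subspace, and the isomorphism is the one induced by the
    identity on cochains ([subquotient_map]).

    The chain condition enters once: each value of a coboundary operator is a
    cocycle, hence so is the whole span of these values ([delta_im_ker]).  A
    recursively generated function of positive level is the result of a last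
    step of the recursion, that is a coboundary, and so has the zero class
    ([recursively_generated_im]).  The criterion for non-vanishing says that a
    class is zero exactly when its representatives are coboundaries. *)

Set Implicit Arguments.
Unset Strict Implicit.
Unset Printing Implicit Defensive.

Import Order.TTheory GRing.Theory Num.Theory numFieldNormedType.Exports.

Local Open Scope classical_set_scope.
Local Open Scope ring_scope.

(** * Subquotients of a module *)

Section SubquotientMaps.
Variables (K : comNzRingType) (V : lmodType K).

Lemma span_sub (G : set V) (U : submodClosed V) :
  (forall v, G v -> v \in U) -> {subset Defs.span G <= U}.
Proof.
move=> GU v /asboolP[s [sG ->]]; rewrite big_seq.
apply: (rpred_sum (S := U)) => p ps.
by apply: (rpredZ (s := U)); exact/GU/sG.
Qed.

Lemma subquotient_class_surj (U W : submodClosed V) (x : subquotient U W) :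
  exists (v : V) (vU : v \in U), x = subquotient_class W vU.
Proof. by have [[v vU] ->] := quotient_class_surj x; exists v, vU. Qed.

Lemma subquotient_class_eq (U W : submodClosed V) (u v : V)
    (uU : u \in U) (vU : v \in U) :
  (subquotient_class W uU == subquotient_class W vU) = (u - v \in W).
Proof. by rewrite /subquotient_class quotient_class_eq. Qed.

Lemma subquotient_class_eq0 (U W : submodClosed V) (v : V) (vU : v \in U) :
  (subquotient_class W vU == 0) = (v \in W).
Proof.
have <- : quotient_class (@restrict_sub K V U W) 0 = 0 :> subquotient U W.
  exact: raddf0.
by rewrite /subquotient_class quotient_class_eq subr0.
Qed.

Section Inclusion.
Variables (U U' W : submodClosed V) (UU' : {subset U <= U'}).

(** The map [U / W -> U' / W] induced by the inclusion of [U] in [U'].  The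
    choice of [repr x] is immaterial by [subquotient_map_class]. *)
Definition subquotient_map (x : subquotient U W) : subquotient U' W :=
  subquotient_class W (UU' (subspace_valP (repr x))).

Lemma subquotient_map_class (v : V) (vU : v \in U) (vU' : v \in U') :
  subquotient_map (subquotient_class W vU) = subquotient_class W vU'.
Proof.
apply/eqP; rewrite subquotient_class_eq.
set r := repr _.
have : quotient_class (@restrict_sub K V U W) r == subquotient_class W vU.
  by rewrite /quotient_class reprK.
by rewrite quotient_class_eq.
Qed.

Lemma subquotient_map_linear : linear subquotient_map.
Proof.
move=> a x y.
have [u [uU ->]] := subquotient_class_surj x.
have [v [vU ->]] := subquotient_class_surj y.
have wU : a *: u + v \in U.
  by apply: (rpredD (S := U)) => //; apply: (rpredZ (s := U)).
have classP (T : submodClosed V) (uT : u \in T) (vT : v \in T)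
    (wT : a *: u + v \in T) :
  a *: subquotient_class W uT + subquotient_class W vT
    = subquotient_class W wT :> subquotient T W.
  rewrite /subquotient_class -linearP; congr quotient_class; exact: val_inj.
rewrite (classP U uU vU wU) (subquotient_map_class uU (UU' uU)).
rewrite (subquotient_map_class vU (UU' vU)).
rewrite (subquotient_map_class wU (UU' wU)).
by rewrite (classP U' _ _ (UU' wU)).
Qed.

HB.instance Definition _ := GRing.isLinear.Build K
  (subquotient U W) (subquotient U' W) _ subquotient_map subquotient_map_linear.

End Inclusion.

Lemma subquotient_map_bij (U U' W : submodClosed V)
    (UU' : {subset U <= U'}) (U'U : {subset U' <= U}) :
  bijective (subquotient_map (W := W) UU').
Proof.
exists (subquotient_map (W := W) U'U) => x.
- have [v [vU ->]] := subquotient_class_surj x.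
  rewrite (subquotient_map_class W UU' vU (UU' _ vU)).
  exact: subquotient_map_class.
- have [v [vU' ->]] := subquotient_class_surj x.
  rewrite (subquotient_map_class W U'U vU' (U'U _ vU')).
  exact: subquotient_map_class.
Qed.

End SubquotientMaps.

(** * Cocycles, solutions and coboundaries *)

Lemma front_snoc (T : Type) n (v : 'I_n -> T) (a : T) : front (snoc v a) = v.
Proof.
apply/funext => i; rewrite /front /snoc.
have -> : widen_ord (leqnSn n) i = lift ord_max i.
  by apply: val_inj; rewrite /= /bump leqNgt ltn_ord.
by rewrite liftK.
Qed.

Lemma last_slot_snoc (T : Type) n (v : 'I_n -> T) (a : T) :
  last_slot (snoc v a) = a.
Proof. by rewrite /last_slot /snoc unlift_none. Qed.

Section Cocycles.
Variables (R : realType) (S : cochain_system R) (f : recursion_structure S).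

Lemma delta_eval_snoc n mu mu' (a : admissible n mu mu') (Z : cochain n mu)
    u p v (z : @zdom R S n mu)
    (zp : zdom (munion mu mu') (snoc (val z) p)) :
  cochain_eval (delta f a Z) (snoc v u) (SigSub (mem_set zp))
    = rec_sum f mu' Z u p v z.
Proof.
rewrite /cochain_eval /= /delta_fun /= front_snoc !last_slot_snoc.
by congr rec_sum; apply: val_inj; rewrite /= front_snoc.
Qed.

Lemma cochain_eval0 n mu v z : cochain_eval (0 : @cochain R S n mu) v z = 0.
Proof.
have := cochain_eval_linear (-1) (0 : @cochain R S n mu) 0 v z.
by rewrite scaler0 addr0 mulN1r addNr.
Qed.

(** An admissible [p] is by definition one for which [snoc z p] lies in the
    domain of [delta a Z], so each instance of the functional equation is a
    value of [delta a Z].  All values arise in this way, because a family of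
    [n + 1] entries is recovered from its [front] and its [last_slot]. *)
Lemma delta_ker_solutions n mu : delta_ker f n mu =i solutions f n mu.
Proof.
move=> Z; apply/idP/idP => /asboolP ZK; apply/asboolP.
  move=> mu' a u p v z zp; rewrite -(delta_eval_snoc a Z u v zp) ZK.
  exact: cochain_eval0.
move=> mu' a; apply: cochain_eval_inj => v z.
rewrite cochain_eval0; apply: ZK => //; exact: front_admissible.
Qed.

Lemma delta_im_ker (hf : chain_condition f) n mu :
  {subset delta_im f n mu <= delta_ker f n mu}.
Proof.
apply: span_sub => Z ZD; case: n mu Z / ZD => n mu mu' a Z.
by apply/asboolP => mu'' a'; exact: hf.
Qed.

Lemma delta_value_im n mu (Z : cochain n mu) :
  delta_value f Z -> Z \in delta_im f n mu.
Proof.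
move=> ZD; apply/asboolP; exists [:: (1, Z)]; split.
  by move=> p; rewrite inE => /eqP->.
by rewrite big_seq1 scale1r.
Qed.

Lemma recursively_generated_im n mu (Z : cochain n mu) :
  (0 < n)%N -> recursively_generated f Z -> Z \in delta_im f n mu.
Proof.
move=> n0 ZG; case: n mu Z / ZG n0 => [//|n mu mu' a Z _ _].
exact/delta_value_im/DeltaValue.
Qed.

End Cocycles.

(** * The cohomology as a space of solutions *)

Theorem proposition2p8 (R : realType) (S : cochain_system R)
    (f : recursion_structure S) (hf : chain_condition f) :
  (forall (n : nat) (mu : modulus S),
    {subset delta_im f n mu <= delta_ker f n mu} /\
    {subset delta_im f n mu <= solutions f n mu} /\
    exists phi : {linear cohomology f n mu ->
                    subquotient (solutions f n mu) (delta_im f n mu)},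
      bijective phi /\
      forall (Z : cochain n mu) (ZK : Z \in delta_ker f n mu)
          (ZS : Z \in solutions f n mu),
        phi (subquotient_class (delta_im f n mu) ZK) =
        subquotient_class (delta_im f n mu) ZS) /\
  (forall (n : nat) (mu : modulus S) (Z : cochain n mu),
    (0 < n)%N -> recursively_generated f Z ->
    exists ZK : Z \in delta_ker f n mu,
      subquotient_class (delta_im f n mu) ZK = 0 :> cohomology f n mu) /\
  (forall (n : nat) (mu : modulus S),
    (exists h : cohomology f n mu, h <> 0) <->
    (exists Z : cochain n mu,
      functional_equation f Z /\ Z \notin delta_im f n mu)).
Proof.
have KS n mu : {subset delta_ker f n mu <= solutions f n mu}.
  by move=> Z; rewrite delta_ker_solutions.
have SK n mu : {subset solutions f n mu <= delta_ker f n mu}.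
  by move=> Z; rewrite delta_ker_solutions.
split=> [n mu|]; last split=> [n mu Z n0 ZG|n mu].
- split; first exact: delta_im_ker.
  split; first by move=> Z /(delta_im_ker hf)/KS.
  exists (subquotient_map (W := delta_im f n mu) (@KS n mu)).
  split=> [|Z ZK ZS]; first exact: subquotient_map_bij (@SK n mu).
  exact: subquotient_map_class.
- have ZI := recursively_generated_im n0 ZG.
  by exists (delta_im_ker hf ZI); apply/eqP; rewrite subquotient_class_eq0.
- split=> [[h /eqP]|[Z [/asboolP ZS ZI]]].
    have [Z [ZK ->]] := subquotient_class_surj h.
    rewrite subquotient_class_eq0 => ZI.
    by exists Z; split=> //; exact/asboolP/KS.
  exists (subquotient_class (delta_im f n mu) (SK _ _ _ ZS)).
  by apply/eqP; rewrite subquotient_class_eq0.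
Qed.
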